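(* Let $A$ be a Banach Bernstein algebra. 1. $A$ is algebraic if and only if it is algebraic of bounded degree. 2. $A$ is train if and only if it is locally train.
   Context: Algebras are not assumed associative, unital or finite-dimensional. A Bernstein algebra over a field $K$ is a commutative $K$-algebra $A$ with a nonzero algebra homomorphism $\omega:A\to K$ satisfying $(x^2)^2=\omega(x)^2x^2$ for all $x$. A Banach Bernstein algebra is a Bernstein algebra over $K=\mathbb{R}$ or $\mathbb{C}$ equipped with a norm making it a (nonassociative) Banach algebra, i.e. a complete norm with $\|xy\|\le\|x\|\,\|y\|$. An element $a$ is algebraic if the subalgebra $\mathrm{alg}(a)$ generated by $a$ is finite-dimensional, and its degree is $\dim\mathrm{alg}(a)$. $A$ is algebraic if all its elements are algebraic, and algebraic of bounded degree if moreover the degrees of all elements are bounded by a common integer. Principal powers: $x^1=x$, $x^{k+1}=x^kx$. $(A,\omega)$ is a train algebra if there are $r\ge2$ and $\gamma_1,\dots,\gamma_{r-1}\in K$ with $x^r+\gamma_1\omega(x)x^{r-1}+\cdots+\gamma_{r-1}\omega(x)^{r-1}x=0$ for all $x\in A$; it is locally train if $\mathrm{alg}(x)$ (with the restricted weight) is a train algebra for every $x$ with $\omega(x)=1$. *)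

(* Defs.v *)
From HB Require Import structures.
From mathcomp Require Import all_boot all_order all_algebra.
From mathcomp Require Import all_classical all_reals all_analysis.
From mathcomp Require Import complex.
Set Implicit Arguments.
Unset Strict Implicit.
Unset Printing Implicit Defensive.
Import Order.TTheory GRing.Theory Num.Theory.
Import numFieldNormedType.Exports.
Local Open Scope classical_set_scope.
Local Open Scope ring_scope.

(* The library's algebra structures are associative, so a nonassociative algebra
   is a module together with a bilinear product [mul]. *)

Section Algebra.
Variables (K : fieldType) (A : lmodType K).

(* No unit is required, so [alg mul a] need not contain the empty product. *)
Definition subalgebra (mul : A -> A -> A) (S : set A) : Prop :=
  submod_closed [in S] /\ (forall x y, S x -> S y -> S (mul x y)).

Definition alg (mul : A -> A -> A) (a : A) : set A :=
  smallest (subalgebra mul) [set a].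

Definition lin_indep (n : nat) (v : 'I_n -> A) : Prop :=
  forall c : 'I_n -> K, \sum_i c i *: v i = 0 -> forall i, c i = 0.

Definition lin_span (n : nat) (v : 'I_n -> A) : set A :=
  [set \sum_i c i *: v i | c in [set: 'I_n -> K]].

Definition has_dim (S : set A) (n : nat) : Prop :=
  exists2 v : 'I_n -> A, lin_indep v & S = lin_span v.

Definition has_degree (mul : A -> A -> A) (a : A) (n : nat) : Prop :=
  has_dim (alg mul a) n.

Definition algebraic_elt (mul : A -> A -> A) (a : A) : Prop :=
  exists n, has_degree mul a n.

Definition algebraic (mul : A -> A -> A) : Prop :=
  forall a, algebraic_elt mul a.

Definition algebraic_bounded (mul : A -> A -> A) : Prop :=
  algebraic mul /\
  exists N : nat, forall a n, has_degree mul a n -> (n <= N)%N.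

(* x^1 = x and x^{k+1} = x^k x; the value at k = 0 is junk (equal to x). *)
Definition ppow (mul : A -> A -> A) (x : A) (k : nat) : A :=
  iter k.-1 (fun y => mul y x) x.

(* The subalgebra S, with the restriction of omega, is a train algebra. *)
Definition train_on (mul : A -> A -> A) (omega : A -> K) (S : set A) : Prop :=
  exists2 r : nat, (2 <= r)%N &
  exists gamma : nat -> K, forall x, S x ->
    ppow mul x r
      + \sum_(1 <= i < r) (gamma i * omega x ^+ i) *: ppow mul x (r - i) = 0.

Definition train (mul : A -> A -> A) (omega : A -> K) : Prop :=
  train_on mul omega [set: A].

Definition locally_train (mul : A -> A -> A) (omega : A -> K) : Prop :=
  forall x, omega x = 1 -> train_on mul omega (alg mul x).

Record bernstein (mul : {bilinear A -> A -> A}) (omega : {scalar A}) : Prop :=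
  Bernstein {
    bernstein_mulC : forall x y, mul x y = mul y x;
    bernstein_weight_neq0 : exists x, omega x != 0;
    bernstein_weightM : forall x y, omega (mul x y) = omega x * omega y;
    bernstein_sqr : forall x,
      mul (mul x x) (mul x x) = (omega x ^+ 2) *: mul x x }.

End Algebra.

Record banach_bernstein (K : numFieldType) (A : completeNormedModType K)
    (mul : {bilinear A -> A -> A}) (omega : {scalar A}) : Prop :=
  BanachBernstein {
    banach_bernsteinW : bernstein mul omega;
    banach_normM : forall x y, `|mul x y| <= `|x| * `|y| }.

(* Main.v *)
(* Both parts combine Baire's theorem with the remark that a polynomial in one
   scalar variable vanishing near 0 vanishes identically. If [A] is the union of
   a sequence of closed sets, each defined by polynomial conditions, then
   one of them contains a ball, hence, by restricting to lines through its
   centre, all of [A].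

   Part 1 uses the closed sets "any [N + 1] nonassociative words in [a] are
   linearly dependent".

   Part 2: let [omega x = 1], [e = x^2] (an idempotent) and [n = x - e].
   Linearizing the Bernstein identity at [x] gives [2 e (x y) = x y] for
   [omega y = 0]. Hence [n^2 = 2 x n] and, inductively, [e n^k = n^k / 2] for
   [k >= 2], that is [n^(k+1) = x n^k - n^k / 2]. So [n^(k+2)] is, up to the
   factor [-2], the value at [x] of [(X^2 - X) (X - 1/2)^k], where [X^i] stands
   for the principal power [x^(i+1)]. A train equation for [alg x] makes [n]
   nilpotent; by Baire the index is bounded uniformly in [x], and the polynomial
   above then yields one train equation for [A]. *)
Require Import Defs.
From mathcomp Require Import all_boot all_order all_algebra.
From mathcomp Require Import all_classical all_reals all_analysis.
From mathcomp Require Import complex.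
Set Implicit Arguments.
Unset Strict Implicit.
Unset Printing Implicit Defensive.
Import Order.TTheory GRing.Theory Num.Theory.
Import numFieldNormedType.Exports.
Local Open Scope classical_set_scope.
Local Open Scope ring_scope.

(** * Real and complex scalars *)

Section Scalars.

Lemma normc_leRI (R : rcfType) (z : R[i]) :
  `|z| <= (`|complex.Re z| + `|complex.Im z|)%:C%C.
Proof.
have sge0 : 0 <= `|complex.Re z| + `|complex.Im z| by rewrite addr_ge0.
rewrite normc_def lecR -(ger0_norm sge0) -[leRHS]sqrtr_sqr ler_wsqrtr//.
by rewrite sqrrD !real_normK ?num_real// lerD2r lerDl mulrn_wge0// mulr_ge0.
Qed.

Lemma complex_compact_ball (R : realType) :
  exists2 B : set (R[i] : numFieldType), compact B &
    forall x : R[i], `|x| <= 1 -> B x.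
Proof.
pose f (p : R * R) : (R[i] : numFieldType) := (p.1 +i* p.2)%C.
(* The unit disc lies in the square of side 2, the continuous image of a product of two segments. *)
exists (f @` (`[-1, 1] `*` `[-1, 1])); last first.
  move=> [a b] xle1; exists (a, b) => //; split => /=; rewrite in_itv/= -ler_norml.
    by rewrite -lecR (le_trans (normc_ge_Re (a +i* b)%C)).
  rewrite -lecR; apply: le_trans xle1.
  by rewrite normc_def lecR /= -sqrtr_sqr; apply: ler_wsqrtr; rewrite lerDr sqr_ge0.
apply: continuous_compact; last exact/compact_setX/segment_compact/segment_compact.
apply: continuous_subspaceT => -[a b].
(* A positive complex number is real, so the radius reduces to its real part [e1]. *)
apply/cvgrPdist_lt => -[e1 e2]; rewrite ltcE/= => /andP[/eqP-> e0].
have e20 : 0 < e1 / 2 by rewrite divr_gt0.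
have /cvgrPdist_lt/(_ _ e20) fst_e : p.1 @[p --> (a, b)] --> a by exact: cvg_fst.
have /cvgrPdist_lt/(_ _ e20) snd_e : p.2 @[p --> (a, b)] --> b by exact: cvg_snd.
near=> p; apply: (le_lt_trans (normc_leRI _)); rewrite ltcR /= [ltRHS]splitr ltrD//.
  by near: p.
by near: p.
Unshelve. all: by end_near. Qed.

Lemma complex_archimedean (R : realType) (e : R[i]) :
  0 < e -> exists n, n.+1%:R^-1 < e.
Proof.
case: e => e1 e2; rewrite ltcE /= => /andP[/eqP -> e0].
exists (Num.truncn e1^-1).
rewrite -[_.+1%:R](rmorph_nat (real_complex R)) -fmorphV ltcR.
by rewrite -ltf_pV2 ?posrE// invrK truncnS_gt.
Qed.

(** These two facts carry all that is used about the scalars: compactness makes linear independence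
    an open condition, and the archimedean property makes the radii in Baire's theorem shrink to
    0. *)
Lemma real_or_complex (R : realType) (K : numFieldType) :
  K = R :> numFieldType \/ K = R[i] :> numFieldType ->
  (exists2 B : set K, compact B & forall x, `|x| <= 1 -> B x) /\
  (forall e : K, 0 < e -> exists n, n.+1%:R^-1 < e).
Proof.
case=> ->; split.
- exists `[-1, 1]%classic; first exact: segment_compact.
  by move=> x; rewrite ler_norml /= in_itv.
- move=> e e0; exists (Num.truncn e^-1).
  by rewrite -ltf_pV2 ?posrE// invrK truncnS_gt.
- exact: complex_compact_ball.
- exact: complex_archimedean.
Qed.

End Scalars.

(** * Baire's theorem *)

Section BaireCover.
Context (K : numFieldType) (T : completeNormedModType K).
Hypothesis archK : forall e : K, 0 < e -> exists n, n.+1%:R^-1 < e.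

(* The library's [Baire] is stated for normed modules over a [realType] only. *)
Lemma baire_closed_cover (C : nat -> set T) :
  (forall n, closed (C n)) -> (forall x, exists n, C n x) ->
  exists n x (e : K), 0 < e /\ ball x e `<=` C n.
Proof.
move=> clC covC; apply: contrapT => noball.
(* The inclusion is required for the ball of twice the new radius, because the limit of the centres
   is only known to lie in the closure of the smaller ball. *)
have step (s : nat * (T * {posnum K})) : exists b : T * {posnum K},
    ball b.1 (2 * b.2%:num) `<=`
      ball s.2.1 s.2.2%:num `&` ~` C s.1 `&` ball b.1 s.1.+1%:R^-1.
  case: s => n [a r] /=.
  have [y [ay nCy]] : exists y, ball a r%:num y /\ ~ C n y.
    apply: contrapT => nex; apply: noball; exists n, a, r%:num; split=> // y ay.
    by apply: contrapT => nCy; apply: nex; exists y.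
  have : nbhs y (ball a r%:num `&` ~` C n `&` ball y n.+1%:R^-1).
    apply: filterI; last by apply: nbhsx_ballx; rewrite invr_gt0.
    apply: filterI; first by apply: open_nbhs_nbhs; split=> //; exact: ball_open.
    by apply: open_nbhs_nbhs; split=> //; exact: closed_openC.
  move=> /nbhs_ballP[e /= e0 sub]; have e20 : 0 < e / 2 by rewrite divr_gt0.
  by exists (y, PosNum e20) => /=; rewrite mulrC divfK ?pnatr_eq0.
have [f Pf] := choice step.
pose fix ar n := if n is p.+1 then f (p, ar p) else (point, PosNum ltr01).
pose a n := (ar n).1; pose r n := (ar n).2%:num.
have r0 n : 0 < r n by rewrite /r.
have rlt2 n : r n <= 2 * r n by rewrite mulr_natl mulr2n lerDl ltW.
have sub2 n := Pf (n, ar n).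
have sub n : ball (a n.+1) (r n.+1) `<=` ball (a n) (r n).
  by move=> x /(le_ball (rlt2 _))/sub2[[]].
have nest n m : (n <= m)%N -> ball (a m) (r m) `<=` ball (a n) (r n).
  move=> /subnK <-; elim: (m - n)%N => [//|k IH]; rewrite addSn.
  exact: subset_trans (sub _) IH.
have mem n m : (n <= m)%N -> ball (a n) (r n) (a m).
  by move=> nm; apply: (nest _ _ nm); exact: ballxx.
have cva : cvg (a @ \oo).
  (* From index [n.+1] on, all centres stay within [n.+1%:R^-1 < e] of [a n.+1]. *)
  apply: cauchy_cvg; apply: cauchy_exP => e /archK[n ne].
  exists (a n.+1), n.+1 => // m nm.
  apply: (le_ball (ltW ne)).
  by have [_ /=] := sub2 n _ (le_ball (rlt2 n.+1) (mem _ _ nm)).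
have [n Cn] := covC (lim (a @ \oo)).
(* That doubled ball was chosen disjoint from [C n], which contains the limit. *)
suff : ball (a n.+1) (2 * r n.+1) (lim (a @ \oo)) by move=> /sub2[[]].
have : \forall m \near \oo, ball (lim (a @ \oo)) (r n.+1) (a m).
  by apply: cva; exact: nbhsx_ballx.
move=> [m0 _ near_m0].
rewrite mulr_natl mulr2n; apply: (ball_triangle (y := a (maxn n.+1 m0))).
  by apply: mem; exact: leq_maxl.
by apply: ball_sym; apply: near_m0; exact: leq_maxr.
Qed.

End BaireCover.

(** * Linear independence *)

Section LinearAlgebra.
Context (K : fieldType) (A : lmodType K).
Implicit Types (n k : nat) (P : set A).

Definition fam_cons n (x : A) (v : 'I_n -> A) (i : 'I_n.+1) : A :=
  if unlift ord0 i is Some j then v j else x.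

Lemma lin_indep_cons n (x : A) (v : 'I_n -> A) :
  lin_indep v -> ~ lin_span v x -> lin_indep (fam_cons x v).
Proof.
move=> vfree xv c; rewrite big_ord_recl /fam_cons unlift_none => c0.
have {}c0 : c ord0 *: x + \sum_(i < n) c (lift ord0 i) *: v i = 0.
  by rewrite -[RHS]c0; congr (_ + _); apply: eq_bigr => i _; rewrite liftK.
have cz : c ord0 = 0.
  apply/eqP; apply: contrapT => /negP cn0; apply: xv.
  exists (fun i => - (c ord0)^-1 * c (lift ord0 i)) => //.
  under eq_bigr do rewrite -scalerA.
  rewrite -scaler_sumr; move/eqP: c0; rewrite addrC addr_eq0 => /eqP->.
  by rewrite scalerN scaleNr opprK scalerA mulVf// scale1r.
move: c0; rewrite cz scale0r add0r => /vfree cl i.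
by case: (unliftP ord0 i) => [j ->|->].
Qed.

Lemma lin_indep_comp n k (f : 'I_n -> 'I_k) (v : 'I_k -> A) :
  injective f -> lin_indep v -> lin_indep (v \o f).
Proof.
move=> finj vfree c c0 i.
(* Coefficients are pushed forward along [f]; by injectivity each fibre has at most one element. *)
pose d j := \sum_(i | f i == j) c i.
have d0 : \sum_j d j *: v j = 0.
  rewrite -[RHS]c0 (partition_big f predT)//=.
  apply: eq_bigr => j _; rewrite scaler_suml.
  by apply: eq_bigr => l /eqP <-.
have := vfree d d0 (f i); rewrite /d (big_pred1 i)// => l.
by rewrite (inj_eq finj).
Qed.

(** The matrix expressing [v] through [w] has zero left kernel, so its rank is [n], which is at most
    its number [k] of columns. *)
Lemma lin_indep_leq n k (v : 'I_n -> A) (w : 'I_k -> A) :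
  lin_indep v -> (forall i, lin_span w (v i)) -> (n <= k)%N.
Proof.
move=> vfree vw.
have /choice[M vM] : forall i, exists c : 'I_k -> K, v i = \sum_l c l *: w l.
  by move=> i; have [c _ <-] := vw i; exists c.
pose B : 'M[K]_(n, k) := \matrix_(i, l) M i l.
suff /eqP<- : \rank B == n by exact: rank_leq_col.
rewrite -[_ == _]/(row_free B) -kermx_eq0.
apply/rowV0P => u /sub_kermxP uB; apply/rowP => i; rewrite mxE.
apply: (vfree (u 0)) => {i}.
under eq_bigr do rewrite vM scaler_sumr.
rewrite exchange_big big1//= => l _.
under eq_bigr do rewrite scalerA.
have : (u *m B) 0 l = 0 by rewrite uB mxE.
rewrite -scaler_suml mxE; under eq_bigr do rewrite mxE.
by move=> ->; rewrite scale0r.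
Qed.

(** An independent family in [P] of maximal size spans [P], since a vector outside its span could be
    added. The bound [N] makes the maximum exist. *)
Lemma max_lin_indep P (N : nat) :
  (forall v : 'I_N.+1 -> A, (forall i, P (v i)) -> ~ lin_indep v) ->
  exists k, exists2 v : 'I_k -> A, (k <= N)%N &
    [/\ forall i, P (v i), lin_indep v & P `<=` lin_span v].
Proof.
move=> dep.
pose Q k := `[< exists2 v : 'I_k -> A, forall i, P (v i) & lin_indep v >].
have Q0 : exists k, Q k.
  exists 0%N; apply/asboolP; exists (fun _ => 0); first by case.
  by move=> c _ [].
have QN k : Q k -> (k <= N)%N.
  move=> /asboolP[v Pv vfree]; rewrite leqNgt; apply/negP => Nk.
  apply: (dep (v \o widen_ord Nk)) => [i|]; first exact: Pv.
  by apply: lin_indep_comp vfree => i j /(congr1 val) /= ij; exact: val_inj.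
have [k /[dup] /QN kN /asboolP[v Pv vfree] kmax] := ex_maxnP Q0 QN.
exists k, v => //; split=> // x Px; apply: contrapT => xv.
have : Q k.+1.
  apply/asboolP; exists (fam_cons x v); last exact: lin_indep_cons.
  by move=> i; rewrite /fam_cons; case: unlift.
by move=> /kmax; rewrite ltnn.
Qed.

Lemma lin_span_sub n (v : 'I_n -> A) (u w : A) (a : K) :
  lin_span v u -> lin_span v w -> lin_span v (a *: u + w).
Proof.
move=> [c _ <-] [d _ <-]; exists (fun i => a * c i + d i) => //.
rewrite scaler_sumr -big_split; apply: eq_bigr => i _.
by rewrite scalerDl scalerA.
Qed.

End LinearAlgebra.

(** * Openness of linear independence *)

Section IndependenceOpen.
Context (K : numFieldType) (A : normedModType K) (T : topologicalType).
Variable B : set K.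
Hypotheses (cptB : compact B) (ballB : forall x, `|x| <= 1 -> B x).

(* A linear relation can be rescaled so that one coefficient is 1 and all are
   bounded by 1, i.e. taken from finitely many compact sets. *)
Lemma near_lin_indep n (f : 'I_n -> T -> A) (x : T) :
  (forall i, {for x, continuous (f i)}) -> lin_indep (f ^~ x) ->
  \forall y \near x, lin_indep (f ^~ y).
Proof.
move=> fcont free.
pose C (i : 'I_n) := [set c : 'rV[K]_n |
  forall j, (if j == i then [set 1] else B) (c 0 j)].
pose P (y : T) (c : 'rV[K]_n) := \sum_j c 0 j *: f j y != 0.
(* Compactness of [C i] turns neighbourhoods of [x] depending on [c] into a single one valid for all
   [c]. *)
have nearC i : \forall y \near x, C i `<=` P y.
  have /compact_near_coveringP : compact (C i).
    apply: (@rV_compact K n (fun j => if j == i then [set 1] else B)) => j.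
    by case: ifP => _; [exact: compact_set1|].
  apply => c Cc.
  have c0 : \sum_j c 0 j *: f j x != 0.
    apply/negP => /eqP /free /(_ i) ci0; have := Cc i.
    by rewrite eqxx /= ci0 => /eqP; rewrite eq_sym oner_eq0.
  pose g (p : 'rV[K]_n * T) := \sum_j p.1 0 j *: f j p.2.
  suff gcont : g p @[p --> (c, x)] --> g (c, x).
    have nb0 : nbhs (g (c, x)) (~` [set 0]).
      apply: open_nbhs_nbhs; split; last exact/eqP.
      exact/closed_openC/accessible_closed_set1/hausdorff_accessible/norm_hausdorff.
    have : nbhs (c, x) (g @^-1` (~` [set 0])) := gcont _ nb0.
    suff sub : g @^-1` (~` [set 0]) `<=` [set p | P p.2 p.1] by exact: filterS.
    by move=> p /= /eqP.
  apply: cvg_big => [|j _]; first exact: add_continuous.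
  apply: cvgZ.
    by apply: (@cvg_comp _ _ _ fst (fun c : 'rV_n => c 0 j) _ (nbhs c));
      [exact: cvg_fst|exact: coord_continuous].
  by apply: (@cvg_comp _ _ _ snd (f j) _ (nbhs x)); [exact: cvg_snd|exact: fcont].
have : \forall y \near x, forall i, C i `<=` P y by exact: filter_forall.
apply: filterS => y CP c c0 i; apply/eqP; apply: contrapT => /negP ci.
(* Dividing by a coefficient of largest modulus puts the relation into [C m]. *)
have [m _ /= mmax] := @real_arg_maxP K _ i predT (fun j => `|c j|) isT
  (fun j _ => normr_real _).
have cm : c m != 0 by rewrite -normr_gt0; apply: lt_le_trans (mmax i isT); rewrite normr_gt0.
suff Cm : C m (\row_j (c j / c m)).
  have /eqP[] := CP m _ Cm.
  under eq_bigr do rewrite mxE mulrC -scalerA.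
  by rewrite -scaler_sumr c0 scaler0.
move=> j; rewrite mxE; case: eqP => [->|_] /=; first by rewrite divff.
by apply: ballB; rewrite normrM normfV ler_pdivrMr ?normr_gt0// mul1r; exact: mmax.
Qed.

End IndependenceOpen.

(** * Polynomial curves *)

Section PolynomialCurves.
Context (K : fieldType) (A : lmodType K).
Implicit Types (g : K -> A) (s : seq ({poly K} * A)) (p : {poly K}).

(** Polynomials in one scalar variable with coefficients in [A]. Lists of pairs avoid choosing a
    basis, and make sums concatenations and products lists of all pairs. *)
Definition poly_curve g :=
  exists s, forall t, g t = \sum_(q <- s) q.1.[t] *: q.2.

Lemma poly_curveD g h :
  poly_curve g -> poly_curve h -> poly_curve (fun t => g t + h t).
Proof. by move=> [s gs] [r hr]; exists (s ++ r) => t; rewrite gs hr big_cat. Qed.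

Lemma poly_curveZ p g : poly_curve g -> poly_curve (fun t => p.[t] *: g t).
Proof.
move=> [s gs]; exists [seq (p * q.1, q.2) | q <- s] => t.
rewrite gs scaler_sumr big_map; apply: eq_bigr => q _.
by rewrite hornerM scalerA.
Qed.

Lemma poly_curve_line (a b : A) : poly_curve (fun t => a + t *: b).
Proof.
exists [:: (1, a); ('X, b)] => t.
by rewrite big_cons big_seq1 hornerC hornerX scale1r.
Qed.

Lemma poly_curve_sum (I : Type) (r : seq I) (P : pred I) (G : I -> K -> A) :
  (forall i, P i -> poly_curve (G i)) ->
  poly_curve (fun t => \sum_(i <- r | P i) G i t).
Proof.
move=> Gp; elim: r => [|i r [s sE]].
  by exists [::] => t; rewrite !big_nil.
have [Pi|nPi] := boolP (P i); last first.
  by exists s => t; rewrite big_cons (negPf nPi).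
have [u uE] := Gp i Pi.
by exists (u ++ s) => t; rewrite big_cons Pi big_cat -sE uE.
Qed.

Lemma poly_curve_bilinear (mul : {bilinear A -> A -> A}) g h :
  poly_curve g -> poly_curve h -> poly_curve (fun t => mul (g t) (h t)).
Proof.
move=> [s gs] [r hr].
exists [seq (q.1 * q'.1, mul q.2 q'.2) | q <- s, q' <- r] => t.
rewrite gs hr linear_sumlz big_allpairs_dep; apply: eq_bigr => q _.
rewrite linear_sumr; apply: eq_bigr => q' _ /=.
by rewrite hornerM linearZl_LR linearZr_LR scalerA.
Qed.

Lemma poly_curve_coord n (b : 'I_n -> A) s :
  (forall q, q \in s -> lin_span b q.2) ->
  exists p : 'I_n -> {poly K},
    forall t, \sum_(q <- s) q.1.[t] *: q.2 = \sum_l (p l).[t] *: b l.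
Proof.
elim: s => [|q s IH] bs.
  by exists (fun=> 0) => t; rewrite big_nil big1// => l _; rewrite horner0 scale0r.
have [r rs|p pE] := IH; first by apply: bs; rewrite inE rs orbT.
have [c _ cE] : lin_span b q.2 by apply: bs; rewrite inE eqxx.
exists (fun l => c l *: q.1 + p l) => t.
rewrite big_cons pE -cE scaler_sumr -big_split; apply: eq_bigr => l _ /=.
by rewrite hornerD hornerZ scalerDl scalerA mulrC.
Qed.

(* After writing the curves in a basis of the space of their coefficients,
   independence at [t1] gives a right inverse [N] of their matrix at [t1], and
   [\det (G *m N)] is a polynomial which does not vanish at [t1]. *)
Lemma poly_curve_lin_indep n (g : 'I_n -> K -> A) (S : set K) (t1 : K) :
  (forall p, p != 0 -> exists2 t, S t & p.[t] != 0) ->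
  (forall i, poly_curve (g i)) -> lin_indep (g ^~ t1) ->
  exists2 t, S t & lin_indep (g ^~ t).
Proof.
move=> Sdense /choice[s gs] free1.
(* Only finitely many vectors occur as coefficients; [b] is a basis of their span. *)
pose cs := flatten [seq [seq q.2 | q <- s i] | i <- enum 'I_n].
have [m [b _ [_ bfree bcs]]] : exists m, exists2 b : 'I_m -> A,
    (m <= size cs)%N & [/\ forall i, b i \in cs, lin_indep b &
      [set` cs] `<=` lin_span b].
  apply: (max_lin_indep (P := [set` cs])) => v vcs vfree.
  suff : ((size cs).+1 <= size cs)%N by rewrite ltnn.
  apply: (lin_indep_leq (w := fun i : 'I_(size cs) => cs`_i) vfree) => i.
  have vi : (index (v i) cs < size cs)%N by rewrite index_mem; exact: vcs.
  exists (fun j => (j == Ordinal vi)%:R) => //.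
  rewrite (bigD1 (Ordinal vi))//= eqxx scale1r big1 ?addr0 ?nth_index//.
    exact: vcs.
  by move=> j /negPf ->; rewrite scale0r.
have /choice[p pE] : forall i, exists p : 'I_m -> {poly K},
    forall t, g i t = \sum_l (p l).[t] *: b l.
  move=> i; have [q qs|p pE] := @poly_curve_coord m b (s i).
    apply: bcs; apply/flattenP; exists [seq q.2 | q <- s i]; last exact: map_f.
    by apply/mapP; exists i; rewrite ?mem_enum.
  by exists p => t; rewrite gs pE.
pose G : 'M[{poly K}]_(n, m) := \matrix_(i, l) p i l.
pose Gat t : 'M[K]_(n, m) := \matrix_(i, l) (p i l).[t].
have comb (c : 'rV[K]_n) t :
    \sum_i c 0 i *: g i t = \sum_l (c *m Gat t) 0 l *: b l.
  under eq_bigr do rewrite pE scaler_sumr.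
  rewrite exchange_big; apply: eq_bigr => l _; rewrite mxE scaler_suml.
  by apply: eq_bigr => i _; rewrite mxE scalerA.
have /row_freeP[N GN] : row_free (Gat t1).
  rewrite -kermx_eq0; apply/rowV0P => c /sub_kermxP cG; apply/rowP => i.
  rewrite mxE; apply: (free1 (c 0)); rewrite comb cG.
  by rewrite big1// => l _; rewrite mxE scale0r.
pose d := \det (G *m map_mx polyC N).
have dE t : d.[t] = \det (Gat t *m N).
  rewrite -[LHS]/(horner_eval t _) -det_map_mx map_mxM/=.
  congr (\det (_ *m _)); apply/matrixP => i j; rewrite !mxE//=.
  by rewrite /horner_eval hornerC.
(* [d] is a nonzero polynomial because its value at [t1] is [\det 1 = 1]. *)
have [|t St dt] := Sdense d.
  apply: contraNneq (oner_neq0 K) => d0.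
  by rewrite -(det1 K n) -GN -dE d0 horner0.
exists t => // c c0 i.
have cG : (\row_j c j) *m Gat t = 0.
  apply/rowP => l; rewrite [RHS]mxE; move: l; apply: bfree; rewrite -comb -[RHS]c0.
  by apply: eq_bigr => j _; rewrite mxE.
have : (\row_j c j) *m (Gat t *m N) = 0 by rewrite mulmxA cG mul0mx.
have unitGN : Gat t *m N \in unitmx by rewrite unitmxE -dE unitfE.
by move=> /(canRL (mulmxK unitGN)) /rowP/(_ i); rewrite mul0mx !mxE.
Qed.

(** A nonzero vector is an independent family of one element, so the previous lemma applies. *)
Lemma poly_curve_eq0 g (S : set K) :
  (forall p, p != 0 -> exists2 t, S t & p.[t] != 0) ->
  poly_curve g -> (forall t, S t -> g t = 0) -> forall t, g t = 0.
Proof.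
move=> Sdense gp gS t; apply/eqP; apply: contrapT => /negP gt.
have free1 : lin_indep (fun _ : 'I_1 => g t).
  move=> c; rewrite big_ord1 => /eqP; rewrite scaler_eq0 (negPf gt) orbF.
  by move=> /eqP c0 i; rewrite ord1.
have [u /gS gu0] := poly_curve_lin_indep (g := fun=> g) Sdense (fun=> gp) free1.
move=> /(_ (fun=> 1)); rewrite big_ord1 gu0 scaler0 => /(_ erefl ord0)/eqP.
by rewrite oner_eq0.
Qed.

End PolynomialCurves.

Lemma ball_poly_dense (K : numFieldType) (e : K) (p : {poly K}) :
  0 < e -> p != 0 -> exists2 t, `|t| < e & p.[t] != 0.
Proof.
(* These are [size p] distinct points, more than [p] can have roots; denominators start at 2 to keep
   the points strictly inside the ball. *)
move=> e0 p0; pose rs := [seq e / n.+2%:R | n <- iota 0 (size p)].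
have rs_uniq : uniq rs.
  rewrite map_inj_uniq ?iota_uniq// => i j.
  move=> /(mulfI (lt0r_neq0 e0))/invr_inj/eqP.
  by rewrite eqr_nat => /eqP[].
have : ~~ all (root p) rs.
  apply: contraTN isT => /(max_poly_roots p0)/(_ rs_uniq).
  by rewrite size_map size_iota ltnn.
move=> /allPn[_ /mapP[n _ ->] pt]; exists (e / n.+2%:R) => //.
rewrite normrM normfV gtr0_norm// normr_nat.
by rewrite ltr_pdivrMr// ltr_pMr// ltr1n.
Qed.

(** * Words and degrees *)

(** Nonassociative monomials in one variable; their values at [a] span [alg mul a]. *)
Inductive word := Var | Op of word & word.

Fixpoint word_eval (A : Type) (mul : A -> A -> A) (w : word) (a : A) : A :=
  if w is Op u v then mul (word_eval mul u a) (word_eval mul v a) else a.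

Section SubalgebraGenerated.
Context (K : fieldType) (A : lmodType K) (mul : {bilinear A -> A -> A}).
Implicit Types (a x y : A) (t : K).

Lemma alg_gen a : alg mul a a.
Proof. by move=> S [_]; apply. Qed.

Lemma alg_mul a x y : alg mul a x -> alg mul a y -> alg mul a (mul x y).
Proof.
by move=> ax ay S Sa; apply: (Sa.1.2); [apply: ax|apply: ay].
Qed.

Lemma alg_lin a t x y : alg mul a x -> alg mul a y -> alg mul a (t *: x + y).
Proof.
move=> ax ay S Sa; have := Sa.1.1.2 t x y; rewrite !inE.
by apply; [apply: ax|apply: ay].
Qed.

Lemma alg_word a w : alg mul a (word_eval mul w a).
Proof. by elim: w => [|u IHu v IHv] /=; [exact: alg_gen|exact: alg_mul]. Qed.

Lemma alg_sub_lin_span n (v : 'I_n -> A) a :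
  (forall i, exists w, v i = word_eval mul w a) ->
  (forall w, lin_span v (word_eval mul w a)) ->
  alg mul a `<=` lin_span v.
Proof.
move=> /choice[u uE] wv; apply: smallest_sub; last by move=> _ ->; exact: wv Var.
split=> [|_ _ [c _ <-] [d _ <-]].
  split=> [|t x y]; last by rewrite !inE; exact: lin_span_sub.
  rewrite inE; exists (fun=> 0) => //.
  by rewrite big1// => i _; rewrite scale0r.
have span_sum (I : Type) (r : seq I) (F : I -> A) :
    (forall i, lin_span v (F i)) -> lin_span v (\sum_(i <- r) F i).
  move=> vF; elim: r => [|i r IH]; last first.
    by rewrite big_cons -[F i]scale1r; apply: lin_span_sub.
  rewrite big_nil; exists (fun=> 0) => //.
  by rewrite big1// => i _; rewrite scale0r.
rewrite linear_sumlz; apply/span_sum => i.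
rewrite linear_sumr; apply/span_sum => j.
rewrite linearZl_LR linearZr_LR !uE scalerA.
(* The product of two spanning words is again a word, hence in the span by hypothesis. *)
have /= [e _ eE] := wv (Op (u i) (u j)); exists (fun l => c i * d j * e l) => //.
by rewrite -eE scaler_sumr; apply: eq_bigr => l _; rewrite scalerA.
Qed.

Lemma poly_curve_word w (g : K -> A) :
  poly_curve g -> poly_curve (fun t => word_eval mul w (g t)).
Proof.
by move=> gp; elim: w => [//|u IHu v IHv] /=; exact: poly_curve_bilinear.
Qed.

Definition words_dependent (N : nat) : set A :=
  [set a | forall w : 'I_N.+1 -> word,
    ~ lin_indep (fun i => word_eval mul (w i) a)].

Lemma degree_words_dependent a n : has_degree mul a n -> words_dependent n a.
Proof.
move=> [v _ algv] w wfree; suff : (n.+1 <= n)%N by rewrite ltnn.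
by apply: (lin_indep_leq (w := v) wfree) => i; rewrite -algv; exact: alg_word.
Qed.

(** A maximal independent family of words has at most [N] members and spans all words, hence all of
    [alg mul a]. *)
Lemma words_dependent_degree a n N :
  words_dependent N a -> has_degree mul a n -> (n <= N)%N.
Proof.
move=> dep [v vfree algv].
have [|k [b kN [bw _ bspan]]] :=
    @max_lin_indep _ _ [set x | exists w, x = word_eval mul w a] N.
  move=> u /choice[w wE]; have -> : u = fun i => word_eval mul (w i) a.
    exact/funext.
  exact: dep.
apply: leq_trans kN; apply: (lin_indep_leq vfree) => i.
apply: (alg_sub_lin_span bw) => [w|]; first by apply: bspan; exists w.
rewrite algv; exists (fun j => (j == i)%:R) => //.
rewrite (bigD1 i)//= eqxx scale1r big1 ?addr0// => j /negPf->.
by rewrite scale0r.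
Qed.

End SubalgebraGenerated.

(** * Banach algebras: continuity of words and bounded degree *)

Section BanachAlgebra.
Context (K : numFieldType) (A : completeNormedModType K).
Context (mul : {bilinear A -> A -> A}).
Hypothesis normM : forall x y, `|mul x y| <= `|x| * `|y|.

Lemma banach_mul_continuous (T : topologicalType) (f g : T -> A) (x : T) :
  {for x, continuous f} -> {for x, continuous g} ->
  {for x, continuous (fun y => mul (f y) (g y))}.
Proof.
move=> fx gx; apply/cvgrPdist_lt => e e0.
(* [M] is chosen so that the two error terms, bounded by [|f x| e / M] and [(1 + |g x|) e / M], add
   up to [e]. *)
pose M := 1 + `|f x| + `|g x|.
have M0 : 0 < M by rewrite /M -addrA ltr_wpDr// addr_ge0.
have eM0 : 0 < e / M by rewrite divr_gt0.
move/cvgrPdist_lt : fx => /(_ _ eM0) f_e.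
move/cvgrPdist_lt : (gx) => /(_ _ ltr01) g_1.
move/cvgrPdist_lt : gx => /(_ _ eM0) g_e.
near=> y.
have -> : mul (f x) (g x) - mul (f y) (g y) =
    mul (f x) (g x - g y) + mul (f x - f y) (g y).
  by rewrite linearBr linearBl /= addrA subrK.
rewrite (le_lt_trans (ler_normD _ _))//.
have gy : `|g y| <= 1 + `|g x|.
  rewrite -[g y](subrK (g x)) (le_trans (ler_normD _ _))// lerD2r distrC.
  by apply: ltW; near: y.
have fxy : `|f x - f y| < e / M by near: y.
have gxy : `|g x - g y| < e / M by near: y.
have -> : e = `|f x| * (e / M) + (e / M) * (1 + `|g x|).
  by rewrite mulrC -mulrDr addrA [`|f x| + 1]addrC divfK// lt0r_neq0.
apply: ler_ltD.
  by rewrite (le_trans (normM _ _))// ler_wpM2l// ltW.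
rewrite (le_lt_trans (normM _ _))//.
apply: (@le_lt_trans _ _ (`|f x - f y| * (1 + `|g x|))); first exact: ler_wpM2l.
by rewrite ltr_pM2r// ltr_wpDr.
Unshelve. all: by end_near. Qed.

Lemma word_continuous w : continuous (word_eval mul w).
Proof.
elim: w => [|u IHu v IHv] x /=; first exact: cvg_id.
by apply: banach_mul_continuous; [exact: IHu|exact: IHv].
Qed.

(** This is the density hypothesis of the lemmas on polynomial curves, for the parameters at which a
    line through [a0] stays in the ball. *)
Lemma line_near (a0 a : A) (e : K) : 0 < e ->
  forall p : {poly K}, p != 0 ->
  exists2 t, ball a0 e (a0 + t *: a) & p.[t] != 0.
Proof.
move=> e0 p p0.
have d0 : 0 < 1 + `|a| by rewrite ltr_wpDr.
have ed : 0 < e / (1 + `|a|) by rewrite divr_gt0.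
have [t te pt] := ball_poly_dense ed p0.
exists t => //; rewrite -ball_normE /= opprD addNKr normrN normrZ.
rewrite (@le_lt_trans _ _ (`|t| * (1 + `|a|)))//.
  by rewrite ler_wpM2l// lerDr.
by rewrite -ltr_pdivlMr.
Qed.

Hypothesis archK : forall e : K, 0 < e -> exists n, n.+1%:R^-1 < e.
Variable B : set K.
Hypotheses (cptB : compact B) (ballB : forall x, `|x| <= 1 -> B x).

Lemma words_dependent_closed N : closed (words_dependent mul N).
Proof.
rewrite -[words_dependent _ _]setCK; apply: open_closedC.
rewrite openE => a /existsNP[w /contrapT free].
have : \forall y \near a, lin_indep (fun i => word_eval mul (w i) y).
  by apply: (near_lin_indep cptB ballB) free => i; exact: word_continuous.
by apply: filterS => y yfree /(_ w).
Qed.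

Lemma algebraic_degree_bounded : algebraic mul -> algebraic_bounded mul.
Proof.
move=> algA; split=> //.
have [|n [a0 [e [e0 sub]]]] := baire_closed_cover archK words_dependent_closed.
  by move=> x; have [n xn] := algA x; exists n; exact: degree_words_dependent xn.
exists n => a m; apply: words_dependent_degree => w free.
(* Words independent at [a], that is at [t = 1], would remain independent at some point of the line
   inside the ball. *)
pose g i t := word_eval mul (w i) (a0 + t *: (a - a0)).
have [|i||t /sub] := @poly_curve_lin_indep _ _ _ g
  [set t | ball a0 e (a0 + t *: (a - a0))] 1.
- exact: line_near.
- by apply: poly_curve_word; exact: poly_curve_line.
- by rewrite /g scale1r addrC subrK.
- by move=> /(_ w).
Qed.

End BanachAlgebra.

(** * Powers in Bernstein algebras *)

Section BernsteinPowers.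
Context (K : numFieldType) (A : lmodType K).
Context (mul : {bilinear A -> A -> A}) (omega : {scalar A}).
Hypothesis bA : bernstein mul omega.
Local Notation "x ** y" := (mul x y) (at level 40, left associativity).
Local Notation pow := (ppow mul).

Let mulC : forall x y, x ** y = y ** x := bernstein_mulC bA.
Let omegaM : forall x y, omega (x ** y) = omega x * omega y :=
  bernstein_weightM bA.

Let mulDl x y z : (x + y) ** z = x ** z + y ** z. Proof. exact: linearDl. Qed.
Let mulDr x y z : z ** (x + y) = z ** x + z ** y. Proof. exact: linearDr. Qed.
Let mulBl x y z : (x - y) ** z = x ** z - y ** z. Proof. exact: linearBl. Qed.
Let mulBr x y z : z ** (x - y) = z ** x - z ** y. Proof. exact: linearBr. Qed.
Let mulZl a x y : (a *: x) ** y = a *: (x ** y). Proof. exact: linearZl_LR. Qed.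
Let mulZr a x y : y ** (a *: x) = a *: (y ** x). Proof. exact: linearZr_LR. Qed.

Lemma addrr_inj (u v : A) : u + u = v + v -> u = v.
Proof.
rewrite -(mulr2n u) -(mulr2n v) -(scaler_nat 2 u) -(scaler_nat 2 v).
by apply: scalerI; rewrite pnatr_eq0.
Qed.

Lemma ppowS x k : pow x k.+2 = pow x k.+1 ** x.
Proof. by []. Qed.

Lemma ppowZ s x k : pow (s *: x) k.+1 = s ^+ k.+1 *: pow x k.+1.
Proof.
elim: k => [|k IH]; first by rewrite expr1.
by rewrite ppowS IH mulZl mulZr scalerA -exprSr.
Qed.

Lemma ppow_weight0 x k : omega x = 0 -> omega (pow x k) = 0.
Proof.
by move=> x0; rewrite /ppow; elim: k.-1 => [//|m IH] /=; rewrite omegaM x0 mulr0.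
Qed.

(** Subtracting the identities at [x + z] and [x - z] keeps the part odd in [z], which is [H].
    Taking [z = y] and [z = 2 y] then separates the linear term from the cubic one, which must
    vanish. *)
Lemma bernstein_linearize x y : omega x = 1 -> omega y = 0 ->
  x ** x ** (x ** y) + x ** x ** (x ** y) = x ** y.
Proof.
move=> x1.
have H z : omega z = 0 ->
    (x ** x + z ** z) ** (x ** z) + (x ** x + z ** z) ** (x ** z) = x ** z.
  move=> z0; have [E EE] : exists E : A, E = x ** x + z ** z by exists (x ** x + z ** z).
  rewrite -EE; set m := x ** z.
  have [D DE] : exists D : A, D = m + m by exists (m + m).
  have sqD : (x + z) ** (x + z) = E + D.
    by rewrite mulDl !mulDr (mulC z x) [x ** z + _]addrC addrACA EE DE.
  have sqB : (x - z) ** (x - z) = E - D.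
    by rewrite mulBl !mulBr (mulC z x) opprB EE DE opprD addrACA.
  have := bernstein_sqr bA (x + z); have := bernstein_sqr bA (x - z).
  rewrite sqB sqD (linearB omega) (linearD omega) x1 z0 subr0 addr0 expr1n !scale1r.
  rewrite mulBl mulDl !mulBr !mulDr /= (mulC D E) opprB.
  rewrite addrACA -opprD => eqB; rewrite [E ** D + D ** D]addrC addrACA => eqD.
  have subK (u v : A) : u + v - (u - v) = v + v by rewrite opprB addrC addrA subrK.
  have : E ** D + E ** D + (E ** D + E ** D) = D + D.
    by rewrite -(subK (E ** E + D ** D) (E ** D + E ** D)) eqD eqB subK.
  by move/addrr_inj; rewrite DE mulDr => /addrr_inj.
move=> y0; set e := x ** x; set m := x ** y; pose q := y ** y.
have two0 : 2 != 0 :> K by rewrite pnatr_eq0.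
have pq : e ** m + q ** m + (e ** m + q ** m) = m by rewrite -mulDl H.
(* After division by 2 this differs from [pq] only by a factor 4 on [q ** m], so [q ** m = 0]. *)
have := H (2 *: y); rewrite (scalarZ omega) y0 mulr0 => /(_ erefl).
rewrite !mulZr mulZl /= -scalerDr => /(scalerI two0).
rewrite scalerA !mulDl mulZl /= -/e -/m -/q -natrM.
move=> /esym/(etrans pq)/addrr_inj/addrI.
rewrite -[LHS]scale1r => /eqP; rewrite -subr_eq0 -scalerBl scaler_eq0.
rewrite subr_eq0 (eqr_nat _ 1 4)/= => /eqP qm0.
by move: pq; rewrite qm0 !addr0.
Qed.

Section WeightOne.
Variable x : A.
Hypothesis x1 : omega x = 1.
Local Notation e := (x ** x).
Local Notation n := (x - x ** x).

Let e_sqr : e ** e = e.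
Proof. by rewrite (bernstein_sqr bA) x1 expr1n scale1r. Qed.

Let n0 : omega n = 0.
Proof. by rewrite (linearB omega) omegaM x1 mulr1 subrr. Qed.

Lemma nil_sqr : n ** n = x ** n + x ** n.
Proof.
by rewrite !mulBr !mulBl e_sqr (mulC e x) opprB.
Qed.

Lemma idem_nil_pow k : e ** pow n k.+2 + e ** pow n k.+2 = pow n k.+2.
Proof.
elim: k => [|k IH].
  by rewrite [pow n 2]nil_sqr mulDr bernstein_linearize.
(* By induction [2 e n^(k+2) = n^(k+2)]; multiplying by [n = x - e] gives this, to which [e] is then
   applied. *)
have xp : pow n k.+3 + pow n k.+3 = x ** pow n k.+2 + x ** pow n k.+2 - pow n k.+2.
  by rewrite ppowS mulC mulBl addrACA -opprD IH.
have pk0 : omega (pow n k.+2) = 0 by exact: ppow_weight0.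
apply: addrr_inj; rewrite -mulDr xp mulBr mulDr (bernstein_linearize x1 pk0).
by rewrite addrACA -opprD IH.
Qed.

Lemma nil_powS k :
  pow n k.+3 = x ** pow n k.+2 - 2^-1 *: pow n k.+2.
Proof.
have half : e ** pow n k.+2 = 2^-1 *: pow n k.+2.
  apply: addrr_inj; rewrite idem_nil_pow -scalerDl.
  by rewrite -[2^-1]mul1r -splitr scale1r.
by rewrite ppowS mulC mulBl half.
Qed.

End WeightOne.

(** * Polynomials in principal powers and train equations *)

Definition ppoly (x : A) (q : {poly K}) : A :=
  \sum_(i < size q) q`_i *: pow x i.+1.

Lemma ppoly_wide x (q : {poly K}) n : (size q <= n)%N ->
  ppoly x q = \sum_(i < n) q`_i *: pow x i.+1.
Proof.
move=> qn; rewrite /ppoly (big_ord_widen _ (fun i => q`_i *: pow x i.+1) qn).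
rewrite big_mkcond; apply: eq_bigr => i _; case: ltnP => // qi.
by rewrite nth_default ?scale0r.
Qed.

Lemma ppoly_lin x c (q r : {poly K}) : ppoly x (c *: q + r) = c *: ppoly x q + ppoly x r.
Proof.
pose m := maxn (size q) (size r).
rewrite (@ppoly_wide _ q m) ?leq_maxl// (@ppoly_wide _ r m) ?leq_maxr//.
rewrite (@ppoly_wide _ _ m); last first.
  rewrite (leq_trans (size_polyD _ _))// geq_max leq_maxr andbT.
  by rewrite (leq_trans (size_scale_leq _ _))// leq_maxl.
rewrite scaler_sumr -big_split; apply: eq_bigr => i _.
by rewrite coefD coefZ scalerDl scalerA.
Qed.

(** The shift of exponents in [ppoly] sends 1 to [x], so a factor [X] raises every principal power
    by one. *)
Lemma ppolyMX x q : ppoly x (q * 'X) = x ** ppoly x q.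
Proof.
rewrite (@ppoly_wide _ (q * 'X) (size q).+1); last first.
  by rewrite (leq_trans (size_polyMleq _ _))// size_polyX addn2.
rewrite big_ord_recl coefMX scale0r add0r mulC linear_sumlz.
by apply: eq_bigr => i _; rewrite coefMX mulZl.
Qed.

Definition nil_poly k : {poly K} := ('X^2 - 'X) * ('X - (2^-1)%:P) ^+ k.

(** The base case is [n^2 = 2 x n = - 2 (x^3 - x^2)]; by [nil_powS] each further power of [n]
    contributes a factor [X - 1/2]. *)
Lemma nil_pow_ppoly x k : omega x = 1 ->
  pow (x - x ** x) k.+2 = (- 2) *: ppoly x (nil_poly k).
Proof.
move=> x1; elim: k => [|k IH].
  rewrite [pow _ 2](nil_sqr x1) mulBr.
  have X1 : ppoly x 1 = x.
    by rewrite (@ppoly_wide _ _ 1) ?size_poly1// big_ord1 coef1 scale1r.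
  have X2 : ppoly x 'X = x ** x by rewrite -[X in ppoly x X]mul1r ppolyMX X1.
  rewrite /nil_poly expr0 mulr1 [X in ppoly x X]addrC -[- 'X]scaleN1r ppoly_lin expr2 ppolyMX X2.
  by rewrite scaleN1r scaleNr scaler_nat mulr2n !opprD opprK.
rewrite (nil_powS x1) IH mulZr scalerA mulrC -scalerA -scalerBr; congr (_ *: _).
rewrite -ppolyMX addrC -scaleNr -ppoly_lin; congr (ppoly x _).
rewrite /nil_poly (exprSr _ k) mulrA; set q := _ * _ ^+ k.
by rewrite mulrBr addrC [q * _%:P]mulrC mul_polyC scaleNr.
Qed.

Lemma nil_poly_monic k : nil_poly k \is monic.
Proof.
rewrite /nil_poly monicMl ?monic_exp ?monicXsubC//.
by rewrite monicE lead_coefDl ?lead_coefXn// size_polyN size_polyX size_polyXn.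
Qed.

Lemma size_nil_poly k : size (nil_poly k) = k.+3.
Proof.
rewrite /nil_poly size_Mmonic ?monic_exp ?monicXsubC//.
  rewrite size_exp_XsubC addnS /= size_polyDl ?size_polyXn ?addSn//.
  by rewrite size_polyN size_polyX.
by rewrite -size_poly_eq0 size_polyDl ?size_polyXn// size_polyN size_polyX.
Qed.

(** Train coefficients are listed from the top; [nil_poly k] is monic of degree [k.+2]. *)
Definition train_coef k i : K := (nil_poly k)`_(k.+2 - i).

Definition train_pow k x : A := pow x k.+3 +
  \sum_(1 <= i < k.+3) (train_coef k i * omega x ^+ i) *: pow x (k.+3 - i).

Lemma train_pow_ppoly k x : omega x = 1 -> train_pow k x = ppoly x (nil_poly k).
Proof.
move=> x1; rewrite /train_pow /ppoly size_nil_poly big_ord_recr /= addrC.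
have := nil_poly_monic k; rewrite monicE lead_coefE size_nil_poly => /eqP->.
rewrite scale1r; congr (_ + _).
rewrite big_add1 big_mkord (reindex_inj rev_ord_inj); apply: eq_bigr => i _ /=.
have ik : (i <= k.+1)%N by rewrite -ltnS.
by rewrite x1 expr1n mulr1 /train_coef !subSS subKn// subSn ?leq_subr// subKn.
Qed.

Lemma train_powZ k s x : train_pow k (s *: x) = s ^+ k.+3 *: train_pow k x.
Proof.
rewrite /train_pow scalerDr -ppowZ scaler_sumr; congr (_ + _).
rewrite !big_nat; apply: eq_bigr => i /andP[i0 ik].
have [m mE] : exists m, (k.+3 - i = m.+1)%N.
  by exists (k.+2 - i)%N; rewrite subSn.
rewrite (scalarZ omega) mE ppowZ !scalerA -mE exprMn; congr (_ *: _).
by rewrite -{2}(subnKC (ltnW ik)) exprD mulrCA mulrAC.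
Qed.

Lemma poly_curve_ppow (g : K -> A) k :
  poly_curve g -> poly_curve (fun t => pow (g t) k).
Proof.
move=> gp; rewrite /ppow; elim: k.-1 => [//|m IH] /=.
exact: poly_curve_bilinear.
Qed.

(** Weight 1 is the polynomial identity above, and nonzero weight follows by homogeneity. An [x] of
    weight 0 is reached along the line [x + t u] with [omega u != 0], whose weight is nonzero for
    [t != 0]. *)
Lemma nil_index_train k :
  (forall x, omega x = 1 -> pow (x - x ** x) k.+2 = 0) -> train mul omega.
Proof.
move=> nilx; exists k.+3 => //; exists (train_coef k) => x _.
rewrite -/(train_pow k x).
have train1 y : omega y = 1 -> train_pow k y = 0.
  move=> y1; have := nil_pow_ppoly k y1; rewrite nilx// train_pow_ppoly// => /esym/eqP.
  by rewrite scaler_eq0 oppr_eq0 pnatr_eq0 => /eqP.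
have train_neq0 y : omega y != 0 -> train_pow k y = 0.
  move=> y0; rewrite -[y]scale1r -(divff y0) -scalerA train_powZ train1 ?scaler0//.
  by rewrite (scalarZ omega) mulVf.
have [x0|] := eqVneq (omega x) 0; last exact: train_neq0.
have [u u0] := bernstein_weight_neq0 bA.
have omega_line t : omega (x + t *: u) = t * omega u.
  by rewrite (linearD omega) (scalarZ omega) x0 add0r.
suff : forall t, train_pow k (x + t *: u) = 0.
  by move=> /(_ 0); rewrite scale0r addr0.
apply: (poly_curve_eq0 (S := [set t | t != 0])).
(* A non-root of [p X] is a nonzero [t] with [p.[t] != 0]. *)
- move=> p p0; have [t _ pt] := ball_poly_dense ltr01 (mulf_neq0 p0 (monic_neq0 (monicX K))).
  by move: pt; rewrite hornerMX mulf_eq0 negb_or => /andP[pt t0]; exists t.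
- apply: poly_curveD; first exact/poly_curve_ppow/poly_curve_line.
  apply: poly_curve_sum => i _.
  have -> : (fun t => (train_coef k i * omega (x + t *: u) ^+ i) *:
        pow (x + t *: u) (k.+3 - i)) =
      (fun t => ((train_coef k i * omega u ^+ i) *: 'X^i).[t] *:
        pow (x + t *: u) (k.+3 - i)).
    by apply/funext => t; rewrite omega_line hornerZ hornerXn exprMn mulrAC mulrA.
  exact/poly_curveZ/poly_curve_ppow/poly_curve_line.
- by move=> t t0; apply: train_neq0; rewrite omega_line mulf_neq0.
Qed.

Lemma train_locally_train : train mul omega -> locally_train mul omega.
Proof.
move=> [r r2 [gamma tr]] x _; exists r => //.
by exists gamma => y _; apply: tr.
Qed.

(** The element [x - x^2] lies in [alg mul x] and has weight 0, so the train equation at it reduces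
    to its leading power. *)
Lemma locally_train_nil x : locally_train mul omega -> omega x = 1 ->
  exists k, pow (x - x ** x) k.+2 = 0.
Proof.
move=> lt x1; have [[|[|r]]// _ [gamma tr]] := lt x x1; exists r.
have n0 : omega (x - x ** x) = 0.
  by rewrite (linearB omega) omegaM x1 mulr1 subrr.
have := tr (x - x ** x); rewrite n0 big_nat big1 ?addr0.
  apply; rewrite addrC -scaleN1r; apply: alg_lin; last exact: alg_gen.
  by apply: alg_mul; exact: alg_gen.
by move=> [|i]// _; rewrite exprS mul0r mulr0 scale0r.
Qed.

(* Homogenizing [x - x^2] makes "some power of [nil_part x] vanishes" true for
   all [x]: on the kernel of [omega] it is [- x^2], whose square is 0. *)
Definition nil_part x : A := omega x *: x - x ** x.

Lemma nil_part_locally_nil : locally_train mul omega ->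
  forall x, exists k, pow (nil_part x) k.+2 = 0.
Proof.
move=> lt x; rewrite /nil_part; have [x0|x0] := eqVneq (omega x) 0.
  exists 0%N; rewrite x0 scale0r add0r ppowS [pow _ 1]/ppow /= -scaleN1r mulZl mulZr.
  by rewrite (bernstein_sqr bA) x0 expr2 mul0r scale0r !scaler0.
pose y := (omega x)^-1 *: x.
have y1 : omega y = 1 by rewrite (scalarZ omega) mulVf.
have xE : x = omega x *: y by rewrite scalerA divff// scale1r.
have [k yk] := locally_train_nil lt y1; exists k.
(* Homogeneity of degree 2 reduces nonzero weight to the weight-one element [y]. *)
have -> : omega x *: x - x ** x = omega x ^+ 2 *: (y - y ** y).
  rewrite {2 3 4}xE mulZl mulZr !scalerA -expr2 scalerBr.
  by rewrite scalerA.
by rewrite ppowZ yk scaler0.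
Qed.

End BernsteinPowers.

(** * Banach Bernstein algebras *)

Section BanachBernstein.
Context (K : numFieldType) (A : completeNormedModType K).
Context (mul : {bilinear A -> A -> A}) (omega : {scalar A}).
Hypothesis hA : banach_bernstein mul omega.

Let bA := banach_bernsteinW hA.
Let normM := banach_normM hA.

(** Norms in the Bernstein identity give [|omega x|^2 |x^2| <= |x^2|^2], whence
    [|omega x|^2 <= |x^2| <= |x|^2] unless [x^2 = 0], when [omega x = 0]. *)
Lemma weight_norm_le (x : A) : `|omega x| <= `|x|.
Proof.
have [xx0|xx0] := eqVneq (mul x x) 0.
  have := bernstein_weightM bA x x; rewrite xx0 linear0 => /esym/eqP.
  by rewrite mulf_eq0 orbb => /eqP->; rewrite normr0.
rewrite -(@ler_pXn2r _ 2)// ?nnegrE//.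
rewrite (le_trans _ (normM x x))//.
rewrite -(@ler_pM2r _ `|mul x x|) ?normr_gt0//.
by rewrite -normrX -normrZ -(bernstein_sqr bA) normM.
Qed.

Lemma weight_continuous : continuous (omega : A -> K).
Proof.
move=> x; apply/cvgrPdist_lt => e e0.
have : \forall y \near x, `|x - y| < e by exact: cvgr_dist_lt.
by apply: filterS => y; rewrite -(linearB omega); apply: le_lt_trans (weight_norm_le _).
Qed.

Lemma nil_part_pow_closed k :
  closed [set x | ppow mul (nil_part mul omega x) k = 0].
Proof.
apply: (@closed_comp _ _ (fun x => ppow mul (nil_part mul omega x) k) [set 0]).
  move=> x _; rewrite /ppow.
  have nilc : {for x, continuous (nil_part mul omega)}.
    apply: cvgB; first by apply: cvgZ; [exact: weight_continuous|exact: cvg_id].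
    by apply: (banach_mul_continuous normM); exact: cvg_id.
  elim: k.-1 => [//|m IH] /=.
  exact: (banach_mul_continuous normM IH nilc).
exact/accessible_closed_set1/hausdorff_accessible/norm_hausdorff.
Qed.

Lemma poly_curve_nil_part (a b : A) :
  poly_curve (fun t => nil_part mul omega (a + t *: b)).
Proof.
have -> : (fun t => nil_part mul omega (a + t *: b)) = (fun t =>
    ((omega a)%:P + omega b *: 'X).[t] *: (a + t *: b)
    + (-1)%:P.[t] *: mul (a + t *: b) (a + t *: b)).
  apply/funext => t; rewrite hornerD !hornerC hornerZ hornerX scaleN1r.
  by rewrite /nil_part (linearD omega) (scalarZ omega) [t * _]mulrC.
apply: poly_curveD; apply: poly_curveZ; first exact: poly_curve_line.
by apply: poly_curve_bilinear; exact: poly_curve_line.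
Qed.

Hypothesis archK : forall e : K, 0 < e -> exists n, n.+1%:R^-1 < e.

Lemma locally_train_train : locally_train mul omega -> train mul omega.
Proof.
move=> lt; have [k [a0 [e [e0 sub]]]] := baire_closed_cover archK
  (fun k => @nil_part_pow_closed k.+2) (nil_part_locally_nil bA lt).
apply: (@nil_index_train _ _ _ _ bA k) => x x1.
(* At [t = 1] the line reaches [x], where [nil_part] is [x - x^2] because the weight is 1. *)
suff /(_ 1) : forall t,
    ppow mul (nil_part mul omega (a0 + t *: (x - a0))) k.+2 = 0.
  by rewrite scale1r addrC subrK /nil_part x1 scale1r.
apply: (poly_curve_eq0 (line_near a0 (x - a0) e0)) => [|t /sub//].
exact/poly_curve_ppow/poly_curve_nil_part.
Qed.

End BanachBernstein.

Unset Implicit Arguments.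

Theorem theorem0p3 (R : realType) (K : numFieldType)
    (hK : K = R :> numFieldType \/ K = R[i] :> numFieldType)
    (A : completeNormedModType K)
    (mul : {bilinear A -> A -> A}) (omega : {scalar A})
    (hA : banach_bernstein mul omega) :
  (algebraic mul <-> algebraic_bounded mul) /\
  (train mul omega <-> locally_train mul omega).
Proof.
have [[B cptB ballB] archK] := real_or_complex hK.
split; split.
- exact: (algebraic_degree_bounded (banach_normM hA) archK cptB ballB).
- by case.
- exact: train_locally_train.
- exact: (locally_train_train hA archK).
Qed.
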